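(* For every integer $r$ with $1\le r\le 7$ (in particular for $r\in\{2,3,4,5,6,7\}$), $R(P;r)=r+6$.
   Context: All hypergraphs are 3-uniform (3-graphs). $P$ denotes the loose 3-uniform path of length 3: the 3-graph on 7 vertices $a,b,c,d,e,f,g$ with the 3 edges $\{a,b,c\},\{c,d,e\},\{e,f,g\}$. $K^3_n$ is the complete 3-graph on $n$ vertices (all 3-subsets are edges). For an integer $r\ge 1$, the Ramsey number $R(P;r)$ is the least integer $n$ such that every coloring of the edges of $K^3_n$ with $r$ colors contains a monochromatic copy of $P$. *)

(* Defs.v *)
From mathcomp Require Import all_boot.
Set Implicit Arguments. Unset Strict Implicit. Unset Printing Implicit Defensive.

Definition edge3 (n : nat) := {S : {set 'I_n} | #|S| == 3}.

Definition colouring (n r : nat) := edge3 n -> 'I_r.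

(* [c] contains a monochromatic copy of the loose path P of length 3:
   seven distinct vertices a,b,c,d,e,f,g whose edges {a,b,c},{c,d,e},{e,f,g}
   all receive the same colour. *)
Definition has_mono_P (n r : nat) (col : colouring n r) : Prop :=
  exists (a b c d e f g : 'I_n)
         (E1 : #|[set a; b; c]| == 3) (E2 : #|[set c; d; e]| == 3)
         (E3 : #|[set e; f; g]| == 3),
    uniq [:: a; b; c; d; e; f; g] /\
    col (exist (fun S : {set 'I_n} => #|S| == 3) _ E1) = col (exist (fun S : {set 'I_n} => #|S| == 3) _ E2) /\
    col (exist (fun S : {set 'I_n} => #|S| == 3) _ E2) = col (exist (fun S : {set 'I_n} => #|S| == 3) _ E3).

Definition arrows_P (r n : nat) : Prop := forall col : colouring n r, has_mono_P col.

Definition is_ramsey_P (r N : nat) : Prop :=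
  arrows_P r N /\ forall n, arrows_P r n -> N <= n.

(* Main.v *)
(* A colour class that is a star is removed by deleting its centre, which lowers
   both r and the number of vertices by one.  So suppose that no class is a star.
   A path-free 3-graph H on n vertices that is not a star falls into three types.

   - Any two edges meet.  Then H contains {0,1,2}, {0,3,4} and an edge missing 0,
     or a complete 3-graph on four vertices.
   - There are disjoint edges e, f and an edge h meeting both; path-freeness forces
     h to lie in S = e + f, so up to labels e = 012, h = 123, f = 345.  Either some
     edge meets both S and its complement, or H splits into S and its complement.
   - Otherwise H splits into the union of the edges meeting a given edge and the
     rest.

   When H does not split, few edges known to be in H suffice for a bound: two
   triples conflict if together with a known edge they form a path (or, in the
   intersecting case, if they are disjoint), and H has at most one edge in each
   clique of the conflict graph.  When H splits, induction on n applies.  In all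
   cases H has fewer than C(n,3)/r edges for n = r + 6, except when n = 12 and H
   splits into two halves of six vertices.  For r = 6, count the 180 triples
   crossing the halves of one such class: another class contains at most 36 of
   them, and at most 35 if it does not itself split into halves.  If all six
   classes split into halves, some triple is crossing for all of them. *)

Require Import Defs.
From mathcomp Require Import all_boot zify.
Set Implicit Arguments. Unset Strict Implicit. Unset Printing Implicit Defensive.

(** * Edge bounds from clique covers of a conflict graph *)

(** A code stands for a vertex set: its entries are positions in a list of the vertices, so that the
    finite checks compute with numbers only. *)
Definition code := seq nat.

(* [has (eqn x) b] rather than [x \in b], to keep kernel computation cheap. *)
Definition meet (a b : code) : nat := count (fun x => has (eqn x) b) a.

(** For the pairwise intersection sizes of three triples, this characterises a copy of P whose
    middle edge is the second triple. *)
Definition loose (ab bc ac : nat) : bool := [&& ab == 1, bc == 1 & ac == 0].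

(** The three disjuncts take [b], [a] and [e] in turn as the middle edge. *)
Definition in_path (a b e : code) : bool :=
  let ab := meet a b in let ae := meet a e in let be := meet b e in
  [|| loose ab be ae, loose ab ae be | loose ae be ab].

Definition path_conflict (base : seq code) (a b : code) : bool :=
  has (in_path a b) base.

Definition disjoint_conflict (base : seq code) (a b : code) : bool :=
  meet a b == 0.

(* In colexicographic order: the success of the first-fit cover below depends on it. *)
Fixpoint subseqs (m k : nat) : seq code :=
  match m, k with
  | _, 0 => [:: [::]]
  | 0, _.+1 => [::]
  | m'.+1, k'.+1 => subseqs m' k ++ [seq rcons s m' | s <- subseqs m' k']
  end.

Section CliqueCover.

Variable conflict : seq code -> code -> code -> bool.

Fixpoint insert_clique (base : seq code) (t : code) (cl : seq (seq code)) :=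
  if cl is q :: cl' then
    if all (conflict base t) q then (t :: q) :: cl'
    else q :: insert_clique base t cl'
  else [:: [:: t]].

(** When [base] consists of edges, such a triple is not an edge: it would form a path with two base
    edges or, in the intersecting case, miss one of them. *)
Definition dead (base : seq code) (t : code) := has (conflict base t) base.

Definition clique_cover (base cands : seq code) : seq (seq code) :=
  foldl (fun cl t => insert_clique base t cl) [::]
        [seq t <- cands | ~~ dead base t].

(* Each triple of [ts] is in turn assumed to be an edge, then discarded. *)
Fixpoint branch_bound (ts base cands : seq code) (bd : nat) : bool :=
  if ts is t :: ts' then
    (size (clique_cover (t :: base) [seq u <- cands | u != t]) < bd)
    && branch_bound ts' base [seq u <- cands | u != t] bd
  else size (clique_cover base cands) <= bd.

(* The first disjunct says that [base] cannot consist of edges. *)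
Definition check (n : nat) (ts base : seq code) (bd : nat) : bool :=
  has (dead base) base || (size base <= bd)
  && branch_bound ts base [seq u <- subseqs n 3 | u \notin base] (bd - size base).

Variable h : pred code.
Hypothesis conflictP : forall base a b,
  all h base -> h a -> h b -> ~~ conflict base a b.

Lemma dead_sound base t : all h base -> dead base t -> ~~ h t.
Proof.
move=> hb /hasP[b bin cb]; apply/negP => ht.
by have := conflictP hb ht (allP hb _ bin); rewrite cb.
Qed.

Let weight (cl : seq (seq code)) := sumn (map (count h) cl).

Lemma weight_insert base t cl :
  weight (insert_clique base t cl) = h t + weight cl.
Proof.
elim: cl => [|q cl IH] /=; first by rewrite /weight /= !addn0.
by case: ifP => _; rewrite /weight /= -?addnA // -/(weight _) IH addnCA.
Qed.

Lemma pairwise_insert base t cl : all (pairwise (conflict base)) cl ->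
  all (pairwise (conflict base)) (insert_clique base t cl).
Proof.
elim: cl => [|q cl IH] //= /andP[qP clP].
by case: ifP => [tq|_] /=; rewrite ?tq qP /= ?IH.
Qed.

Lemma count_clique base q :
  all h base -> pairwise (conflict base) q -> count h q <= 1.
Proof.
move=> hb; elim: q => [|t q IH] //= /andP[tq /IH {}IH].
case ht: (h t) => //; rewrite add1n ltnS leqNgt -has_count.
apply/hasPn => u uq; apply/negP => hu.
by have := conflictP hb ht hu; rewrite (allP tq).
Qed.

Lemma fold_insert base s cl : all (pairwise (conflict base)) cl ->
  let cl' := foldl (fun cl t => insert_clique base t cl) cl s in
  weight cl' = count h s + weight cl /\ all (pairwise (conflict base)) cl'.
Proof.
elim: s cl => [|t s IH] cl clP //=.
have [-> ->] := IH _ (pairwise_insert t clP).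
by rewrite weight_insert addnCA addnA.
Qed.

(** Dead triples are not edges, and each clique contains at most one edge. *)
Lemma clique_cover_sound base cands :
  all h base -> count h cands <= size (clique_cover base cands).
Proof.
move=> hb; rewrite /clique_cover.
have -> : count h cands = count h [seq t <- cands | ~~ dead base t].
  rewrite count_filter; apply: eq_count => t /=.
  by case ht: (h t) => //=; apply/esym/negP => /(dead_sound hb); rewrite ht.
set s := filter _ _; have [W P] := @fold_insert base s [::] isT.
move: W P; rewrite addn0 => <-; rewrite /weight.
elim: (foldl _ _ _) => [|q cl IH] //= /andP[qP /IH clP].
by rewrite -add1n leq_add // (count_clique hb).
Qed.

(** If [t] is an edge, it may join the base, and fewer than [bd] of the other candidates are edges;
    if it is not, dropping it loses nothing. *)
Lemma branch_bound_sound ts base cands bd : all h base -> uniq cands ->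
  branch_bound ts base cands bd -> count h cands <= bd.
Proof.
move=> hb; elim: ts cands => [|t ts IH] cands uc /=.
  exact/leq_trans/clique_cover_sound.
have countE : count h cands <= count h [seq u <- cands | u != t] + h t.
  have [tc|tc] := boolP (t \in cands).
    by rewrite (permP (perm_to_rem tc)) /= rem_filter // addnC.
  rewrite (eq_in_filter (a2 := predT)) ?filter_predT ?leq_addr // => u uc'.
  by apply: contraNneq tc => <-.
case/andP=> lt_bd /IH bnd; apply: leq_trans countE _.
case ht: (h t); last by rewrite addn0 bnd ?filter_uniq.
rewrite addn1; apply: leq_ltn_trans lt_bd.
by apply: clique_cover_sound; rewrite /= ht.
Qed.

Lemma check_sound n ts base bd : all h base -> uniq (subseqs n 3) ->
  check n ts base bd -> count h (subseqs n 3) <= bd.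
Proof.
move=> hb us; rewrite /check.
have /negbTE-> /= : ~~ has (dead base) base.
  by apply/hasPn => t /(allP hb) ht; apply/negP => /(dead_sound hb); rewrite ht.
case/andP=> le_bd /branch_bound_sound bnd.
rewrite -(permP (permEl (perm_filterC (mem base) _))) count_cat.
rewrite -(subnKC le_bd) leq_add ?bnd ?filter_uniq //.
apply: leq_trans (count_size _ _) _.
by apply: uniq_leq_size; rewrite ?filter_uniq // => x; rewrite mem_filter => /andP[].
Qed.

End CliqueCover.

(** * Increasing sequences of labels *)

Lemma subseqs_lt m k s i : s \in subseqs m k -> i \in s -> i < m.
Proof.
elim: m k s => [|m IH] [|k] s; rewrite ?inE ?mem_cat //; do ?by move=> /eqP->.
case/orP=> [/IH/[apply]/ltnW // | /mapP[s' s'in ->]].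
by rewrite mem_rcons inE => /predU1P[-> // | /(IH _ _ s'in)/ltnW].
Qed.

Lemma subseqs_uniq m k : uniq (subseqs m k).
Proof.
elim: m k => [|m IH] [|k] //=; rewrite cat_uniq IH map_inj_uniq ?IH ?andbT /=.
  apply/hasPn => _ /mapP[s _ ->]; apply/negP => /(subseqs_lt (i := m)).
  by rewrite mem_rcons mem_head ltnn => /(_ isT).
by move=> s s' /rcons_inj[].
Qed.

Lemma filter_iota_subseqs p m :
  [seq i <- iota 0 m | p i] \in subseqs m (count p (iota 0 m)).
Proof.
elim: m => [|m IH] //; rewrite -addn1 iotaD filter_cat count_cat /= add0n addn0.
case: (p m); rewrite /= ?cats0 ?cats1 ?addn1 ?addn0 /=.
  by rewrite mem_cat (map_f (rcons^~ m)) ?orbT.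
by case: (count _ _) IH => [|k] IH; rewrite ?mem_cat ?IH //; case: (m) IH.
Qed.

(** * 3-graphs and their coding by vertex labels *)

Section Hypergraph.

Variable T : finType.
Implicit Types (Y e : {set T}) (H : {set {set T}}) (l : seq T).

Definition triples Y : {set {set T}} := [set e : {set T} | e \subset Y & #|e| == 3].

Definition path_free H := [forall a in H, forall b in H, forall c in H,
  ~~ loose #|a :&: b| #|b :&: c| #|a :&: c|].

Definition intersecting H := [forall a in H, forall b in H, #|a :&: b| != 0].

Definition star Y H := [exists v in Y, [forall e in H, v \in e]].

Lemma path_freeP H : reflect
  (forall a b c, a \in H -> b \in H -> c \in H ->
     ~~ loose #|a :&: b| #|b :&: c| #|a :&: c|)
  (path_free H).
Proof.
apply: (iffP forall_inP) => [F a b c aH bH cH | F a aH].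
  by have /forall_inP/(_ b bH)/forall_inP/(_ c cH) := F a aH.
by apply/forall_inP => b bH; apply/forall_inP => c cH; apply: F.
Qed.

Lemma intersectingP H : reflect
  (forall a b, a \in H -> b \in H -> #|a :&: b| != 0) (intersecting H).
Proof.
apply: (iffP forall_inP) => [F a b aH bH | F a aH].
  by have /forall_inP/(_ b bH) := F a aH.
by apply/forall_inP => b bH; apply: F.
Qed.

Section Labelling.

Variables (x0 : T) (l : seq T).
Hypothesis ul : uniq l.

Definition decode (a : code) : {set T} := [set x in map (nth x0 l) a].

Definition encode (e : {set T}) : code :=
  [seq i <- iota 0 (size l) | nth x0 l i \in e].

Definition wf (a : code) : bool := uniq a && all (fun i => i < size l) a.

Lemma mem_decode a i : wf a -> i < size l -> (nth x0 l i \in decode a) = (i \in a).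
Proof.
move=> /andP[_ /allP wa] li; rewrite inE; apply/mapP/idP => [[j ja E]|ia].
  by move/eqP: E; rewrite nth_uniq ?(wa j) // => /eqP->.
by exists i.
Qed.

Lemma card_decode a : wf a -> #|decode a| = size a.
Proof.
move=> /andP[ua /allP wa]; rewrite cardsE -(size_map (nth x0 l)); apply/card_uniqP.
rewrite map_inj_in_uniq // => i j /wa li /wa lj E.
by apply/eqP; rewrite -(nth_uniq x0 li lj ul) E.
Qed.

Lemma meetE a b : wf a -> wf b -> #|decode a :&: decode b| = meet a b.
Proof.
move=> wa wb; have -> : meet a b = size [seq x <- a | x \in b].
  rewrite size_filter; apply: eq_count => x.
  by elim: b {wb} => //= y b ->; rewrite inE eqnE.
rewrite -card_decode; last first.
  case/andP: wa => ua la; rewrite /wf filter_uniq //=.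
  by apply/allP => x; rewrite mem_filter => /andP[_ /(allP la)].
apply: eq_card => x; rewrite !inE; apply/andP/mapP.
  case=> /mapP[i ia ->] xb; exists i => //; rewrite mem_filter ia andbT.
  have li : i < size l by case/andP: wa => _ /allP ->.
  by rewrite -mem_decode // inE.
case=> i; rewrite mem_filter => /andP[ib ia] ->.
by split; apply: map_f.
Qed.

Lemma encodeK e : e \subset l -> decode (encode e) = e.
Proof.
move=> /subsetP el; apply/setP => x; rewrite inE; apply/mapP/idP.
  by case=> i; rewrite mem_filter => /andP[ie _] ->.
move=> xe; have xl := el _ xe; exists (index x l); last by rewrite nth_index.
by rewrite mem_filter nth_index // xe mem_iota index_mem.
Qed.

Lemma wf_encode e : wf (encode e).
Proof.
rewrite /wf filter_uniq ?iota_uniq //=; apply/allP => i.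
by rewrite mem_filter mem_iota => /and3P[].
Qed.

Lemma wf_small a : 6 < size l -> uniq a -> all (fun i => i < 7) a -> wf a.
Proof.
by move=> l7 ua /allP a7; rewrite /wf ua; apply/allP => i /a7 /leq_trans; apply.
Qed.

Definition has_code H : pred code := [pred a | wf a && (decode a \in H)].

(** Every edge is the decoding of its own increasing code, and [subseqs] lists that code. *)
Lemma count_codes H : H \subset triples [set x in l] ->
  #|H| <= count (has_code H) (subseqs (size l) 3).
Proof.
move=> /subsetP Hl; rewrite -size_filter -(size_map decode).
apply: leq_trans (card_size _); apply/subset_leq_card/subsetP => e eH.
have := Hl e eH; rewrite inE => /andP[/subsetP el /eqP e3].
have E : decode (encode e) = e.
  by apply: encodeK; apply/subsetP => x /el; rewrite inE.
apply/mapP; exists (encode e) => //; rewrite mem_filter /has_code inE wf_encode E eH.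
by rewrite -e3 -{2}E (card_decode (wf_encode e)) size_filter filter_iota_subseqs.
Qed.

Lemma path_conflictP H : path_free H -> forall base a b,
  all (has_code H) base -> has_code H a -> has_code H b ->
  ~~ path_conflict base a b.
Proof.
move=> /path_freeP F base a b /allP hb /andP[wa aH] /andP[wb bH].
apply/hasPn => e /hb/andP[we eH]; rewrite /in_path -!meetE //.
have := F _ _ _ bH aH eH; have := F _ _ _ aH eH bH.
rewrite (setIC (decode b) (decode a)) (setIC (decode e) (decode b)).
by rewrite !negb_or (F _ _ _ aH bH eH) => -> ->.
Qed.

Lemma disjoint_conflictP H : intersecting H -> forall base a b,
  all (has_code H) base -> has_code H a -> has_code H b ->
  ~~ disjoint_conflict base a b.
Proof.
move=> /intersectingP F base a b _ /andP[wa aH] /andP[wb bH].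
by rewrite /disjoint_conflict -meetE // F.
Qed.

Lemma check_card conflict H ts base bd :
  (forall base a b, all (has_code H) base -> has_code H a -> has_code H b ->
     ~~ conflict base a b) ->
  H \subset triples [set x in l] -> all (has_code H) base ->
  check conflict (size l) ts base bd -> #|H| <= bd.
Proof.
move=> cP Hl hb /(check_sound cP hb (subseqs_uniq _ _)).
exact/leq_trans/count_codes.
Qed.

End Labelling.

End Hypergraph.

(** * Computed bounds for the configurations *)

(* The possible codes of an edge when labels 0, ..., m - 1 are already in use and
   its other vertices receive the next labels. *)
Definition extensions (m : nat) : seq code :=
  flatten [seq [seq s ++ iota m (3 - size s) | s <- subseqs m k] | k <- iota 0 4].

(** Entries for n = 7, ..., 13. The entry at 7 is C(6,3). From 8 on they are the largest integers
    below C(n,3)/(n-6), except at 12, where 36 is lowered to 35 for the count of crossing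
    triples. *)
Definition nonstar_bound (n : nat) : nat :=
  nth 0 [:: 20; 27; 27; 29; 32; 35; 40] (n - 7).

Definition config : seq code := [:: [:: 0; 1; 2]; [:: 1; 2; 3]; [:: 3; 4; 5]].

(* Found by computer search.  Branching is needed only for n = 13 with the
   crossing edges {1,2,6} and {4,5,6}, two branchings for each of them. *)
Definition branches : seq code :=
  [:: [:: 4; 5; 10]; [:: 4; 5; 9]; [:: 1; 2; 7]; [:: 1; 2; 8]].

(** Here [t] is an edge with one or two vertices among the six of [config]; codes that need a label
    outside the n vertices are filtered out. *)
Lemma config_check :
  all (fun n =>
    all (fun t => check path_conflict n branches (t :: config) (nonstar_bound n))
        [seq t <- extensions 6 | 0 < meet t (iota 0 6) < 3 & all (fun i => i < n) t])
    (iota 7 7).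
Proof. by vm_compute. Qed.

(** The two fixed edges share only the vertex 0, and [t] is an edge missing it, which exists because
    0 is not the centre of a star. *)
Lemma intersecting_check :
  all (fun n =>
    all (fun t => check disjoint_conflict n [::]
           [:: t; [:: 0; 1; 2]; [:: 0; 3; 4]] (nonstar_bound n))
        [seq t <- extensions 5 | meet t [:: 0] == 0])
    (iota 7 7).
Proof. by vm_compute. Qed.

(** Serves the case where any two distinct edges share two vertices. *)
Lemma tetrahedron_check :
  all (fun n => check disjoint_conflict n [::]
    [:: [:: 0; 1; 2]; [:: 0; 1; 3]; [:: 0; 2; 3]; [:: 1; 2; 3]] (nonstar_bound n))
    (iota 7 7).
Proof. by vm_compute. Qed.


(** * Structure and size of path-free 3-graphs *)

Section Structure.

Variable T : finType.
Implicit Types (Y e : {set T}) (H : {set {set T}}) (p : seq T).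

(** Labels go first to [p], then to the vertices of [e] outside [p], then to the rest of [Y]; so [e]
    receives one of the few codes in [extensions]. *)
Lemma label_edge x0 p Y e :
  uniq p -> {subset p <= Y} -> e \in triples Y ->
  exists q a, [/\ uniq (p ++ q), [set x in p ++ q] = Y, a \in extensions (size p),
                  wf (p ++ q) a & decode x0 (p ++ q) a = e].
Proof.
move=> up pY; rewrite inE => /andP[/subsetP eY /eqP e3].
pose q1 := [seq x <- enum e | x \notin p].
pose q2 := [seq x <- enum Y | x \notin p & x \notin e].
pose l := p ++ q1 ++ q2.
have q1E x : (x \in q1) = (x \notin p) && (x \in e) by rewrite mem_filter mem_enum.
have q2E x : (x \in q2) = [&& x \notin p, x \notin e & x \in Y].
  by rewrite mem_filter mem_enum andbA.
have ul : uniq l.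
  rewrite !cat_uniq up !(filter_uniq _ (enum_uniq _)) /= andbT; apply/andP; split.
    by apply/hasPn => x; rewrite mem_cat q1E q2E => /orP[] /andP[].
  by apply/hasPn => x; rewrite q1E q2E => /and3P[_ /negbTE-> _]; rewrite andbF.
have lY : [set x in l] = Y.
  apply/setP => x; rewrite !inE !mem_cat q1E q2E.
  case: (boolP (x \in p)) => [/pY-> // |_] /=.
  by case: (boolP (x \in e)) => [/eY-> // |_].
have el : e \subset l by apply/subsetP => x /eY; rewrite -lY inE.
exists (q1 ++ q2), (encode x0 l e); split=> //; last 2 first.
- exact: wf_encode.
- exact: encodeK.
have := card_decode x0 ul (wf_encode x0 l e); rewrite encodeK // e3.
rewrite /encode /l !size_cat !iotaD !filter_cat !add0n.
have -> : [seq i <- iota (size p) (size q1) | nth x0 l i \in e] = iota (size p) (size q1).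
  apply/all_filterP/allP => i; rewrite mem_iota => /andP[pi iq].
  rewrite /l nth_cat ltnNge pi /= nth_cat ltn_subLR // iq.
  have : nth x0 q1 (i - size p) \in q1 by rewrite mem_nth // ltn_subLR.
  by rewrite q1E => /andP[].
have -> : [seq i <- iota (size p + size q1) (size q2) | nth x0 l i \in e] = [::].
  apply/eqP; rewrite -[_ == _]negbK -has_filter; apply/hasPn => i.
  rewrite mem_iota => /andP[pi iq].
  rewrite /l catA nth_cat size_cat ltnNge pi /=.
  have : nth x0 q2 (i - (size p + size q1)) \in q2 by rewrite mem_nth // ltn_subLR.
  by rewrite q2E => /and3P[_ /negbTE->].
rewrite cats0 size_cat size_iota => s3.
set s := [seq i <- _ | _] in s3 *.
have -> : size q1 = 3 - size s by rewrite s3 addKn.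
apply/flattenP; exists [seq s' ++ iota (size p) (3 - size s') | s' <- subseqs (size p) (size s)].
  have s4 : size s < 4 by lia.
  apply/mapP; exists (size s) => //.
  by case: (size s) s4 => [|[|[|[|]]]].
by apply/mapP; exists s; rewrite // size_filter filter_iota_subseqs.
Qed.

Lemma decode_sub x0 l a e : uniq l -> wf l a -> size a = #|e| ->
  all (fun x => x \in e) (map (nth x0 l) a) -> decode x0 l a = e.
Proof.
move=> ul wa ae /allP sub; apply/eqP.
rewrite eqEcard card_decode // ae leqnn andbT.
by apply/subsetP => x; rewrite inE => /sub.
Qed.


Lemma label_check (conflict : seq code -> code -> code -> bool) x0 l Y H ts base bd :
  (forall l, uniq l -> forall base a b,
     all (has_code x0 l H) base -> has_code x0 l H a -> has_code x0 l H b ->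
     ~~ conflict base a b) ->
  uniq l -> [set x in l] = Y -> H \subset triples Y ->
  all (has_code x0 l H) base -> check conflict #|Y| ts base bd -> #|H| <= bd.
Proof.
move=> cP ul lY HY hb; rewrite -lY cardsE (card_uniqP ul).
by apply: check_card hb; rewrite ?lY //; apply: cP.
Qed.

Lemma card_triple H Y e : H \subset triples Y -> e \in H -> #|e| = 3.
Proof. by move=> /subsetP HY /HY; rewrite inE => /andP[_ /eqP]. Qed.

Lemma config_bound Y H e f h g : path_free H -> H \subset triples Y ->
  7 <= #|Y| <= 13 -> e \in H -> f \in H -> h \in H -> g \in H ->
  #|e :&: f| = 0 -> #|e :&: h| = 2 -> #|h :&: f| = 1 ->
  0 < #|g :&: (e :|: f)| < 3 -> #|H| <= nonstar_bound #|Y|.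
Proof.
move=> pf HY Yn eH fH hH gH ef eh hf ge.
have [[e3 f3] h3] := (card_triple HY eH, card_triple HY fH, card_triple HY hH).
(* The labels 0, ..., 5 will be a, b, c, d, x, y, with e = abc, h = bcd and f = dxy. *)
have /cards2P[b [c [bc ehE]]] : #|e :&: h| == 2 by apply/eqP.
have /cards1P[d hfE] : #|h :&: f| == 1 by apply/eqP.
have /cards1P[a eE] : #|e :\: h| == 1 by rewrite cardsD e3 eh.
have /cards2P[x [y [xy fE]]] : #|f :\: h| == 2 by rewrite cardsD setIC hf f3.
have disj z : z \in e -> z \in f = false.
  by move=> ze; have /eqP := ef; rewrite cards_eq0 => /eqP/setP/(_ z); rewrite !inE ze.
(* Vertices with different membership patterns are distinct; among the six only b, c and x, y share
   a pattern. *)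
pose mem3 z := (z \in e, z \in h, z \in f).
have ma : mem3 a = (true, false, false).
  by have := set11 a; rewrite -eE inE /mem3 => /andP[/negbTE-> ae]; rewrite ae disj.
have [mb mc] : mem3 b = (true, true, false) /\ mem3 c = (true, true, false).
  by split; [have := set21 b c | have := set22 b c];
     rewrite -ehE inE /mem3 => /andP[ze ->]; rewrite ze disj.
have md : mem3 d = (false, true, true).
  have := set11 d; rewrite -hfE inE /mem3 => /andP[-> df]; rewrite df.
  by congr (_, _, _); apply: contraTF df => /disj->.
have [mx my] : mem3 x = (false, false, true) /\ mem3 y = (false, false, true).
  by split; [have := set21 x y | have := set22 x y];
     rewrite -fE inE /mem3 => /andP[/negbTE-> zf]; rewrite zf;
     congr (_, _, _); apply: contraTF zf => /disj->.
have neq u v : mem3 u != mem3 v -> u != v by apply: contraNneq => ->.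
pose p := [:: a; b; c; d; x; y].
have up : uniq p.
  by rewrite /= !inE !negb_or bc xy !neq ?ma ?mb ?mc ?md ?mx ?my.
have sub z : mem3 z != (false, false, false) -> z \in Y.
  move=> mz; have {mz} : [|| z \in e, z \in h | z \in f].
    by move: mz; rewrite /mem3; do 3![case: (z \in _)].
  move/subsetP: HY => HY; have := HY _ eH; have := HY _ hH; have := HY _ fH.
  rewrite !inE => /andP[/subsetP sf _] /andP[/subsetP sh _] /andP[/subsetP se _].
  by case/or3P => [/se|/sh|/sf].
have pY : {subset p <= Y}.
  move=> z; rewrite !inE => /or4P[||| /or3P[||]] /eqP-> //; apply: sub;
  by rewrite ?ma ?mb ?mc ?md ?mx ?my.
have [q [t [ul lY tin wt tg]]] := label_edge a up pY (subsetP HY _ gH).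
set l := p ++ q in ul lY wt tg.
have ln : size l = #|Y| by rewrite -lY cardsE (card_uniqP ul).
have l7 : 6 < size l by rewrite ln; case/andP: Yn.
have wl s := @wf_small T l s l7.
pose in1 := congr1 (fun m : bool * bool * bool => m.1.1).
pose in2 := congr1 (fun m : bool * bool * bool => m.1.2).
pose in3 := congr1 (fun m : bool * bool * bool => m.2).
have [ae be ce] : [/\ a \in e, b \in e & c \in e].
  by split; [exact: in1 ma | exact: in1 mb | exact: in1 mc].
have [bh ch dh] : [/\ b \in h, c \in h & d \in h].
  by split; [exact: in2 mb | exact: in2 mc | exact: in2 md].
have [df xf yf] : [/\ d \in f, x \in f & y \in f].
  by split; [exact: in3 md | exact: in3 mx | exact: in3 my].
have [d1 d2 d3] : [/\ decode a l [:: 0; 1; 2] = e, decode a l [:: 1; 2; 3] = h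
                   & decode a l [:: 3; 4; 5] = f].
  split; apply: (decode_sub ul); rewrite ?wl ?e3 ?h3 ?f3 //=;
  by rewrite ?ae ?be ?ce ?bh ?ch ?dh ?df ?xf ?yf.
have SE : decode a l (iota 0 6) = e :|: f.
  apply: (decode_sub ul); rewrite ?wl // ?cardsU ?ef ?e3 ?f3 //= !inE.
  by rewrite ae be ce df xf yf !orbT.
apply: (label_check (fun l ul => path_conflictP (x0 := a) ul pf) ul lY HY (base := t :: config)).
- apply/allP => s; rewrite !inE => /or4P[] /eqP->; rewrite /has_code inE.
  + by rewrite wt tg.
  + by rewrite wl ?d1.
  + by rewrite wl ?d2.
  + by rewrite wl ?d3.
have /allP/(_ #|Y|) := config_check; rewrite mem_iota => /(_ Yn)/allP; apply.
rewrite mem_filter tin andbT -(meetE a ul wt) ?wl // tg SE ge -ln.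
by case/andP: wt.
Qed.

Lemma intersecting_bound Y H : intersecting H -> H \subset triples Y ->
  7 <= #|Y| <= 13 -> ~~ star Y H -> #|H| <= nonstar_bound #|Y|.
Proof.
move=> /[dup] iH /intersectingP IH HY Yn /exists_inPn nst.
have miss v : v \in Y -> exists2 g, g \in H & v \notin g.
  by move=> /nst /forall_inPn.
have edgeY e x : e \in H -> x \in e -> x \in Y.
  by move=> /(subsetP HY); rewrite inE => /andP[/subsetP eY _] /eY.
have H3 := card_triple HY.
have neqP (u v : T) (A : {set T}) : u \in A -> v \notin A -> u != v.
  by move=> uA; apply: contraNneq => <-.
(* Two edges meeting in a single vertex [v], together with an edge missing [v], give the
   configuration of [intersecting_check]. *)
have [/existsP[e /existsP[f /and3P[eH fH /cards1P[v ef]]]]|no1] :=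
    boolP [exists e, exists f, [&& e \in H, f \in H & #|e :&: f| == 1]].
- have /cards2P[a [b [ab eE]]] : #|e :\: f| == 2 by rewrite cardsD ef cards1 H3.
  have /cards2P[c [d [cd fE]]] : #|f :\: e| == 2.
    by rewrite cardsD setIC ef cards1 H3.
  have /andP[ve vf] : (v \in e) && (v \in f) by rewrite -in_setI ef inE.
  have [/andP[af ae] /andP[bf be]] :
      (a \notin f) && (a \in e) /\ (b \notin f) && (b \in e).
    by rewrite -!in_setD eE !inE !eqxx orbT.
  have [/andP[ce cf] /andP[de df]] :
      (c \notin e) && (c \in f) /\ (d \notin e) && (d \in f).
    by rewrite -!in_setD fE !inE !eqxx orbT.
  have [g gH vg] := miss v (edgeY _ _ eH ve).
  pose p := [:: v; a; b; c; d].
  have up : uniq p.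
    by rewrite /= !inE !negb_or ab cd (neqP v a f) ?(neqP v b f) ?(neqP v c e)
      ?(neqP v d e) ?(neqP a c e) ?(neqP a d e) ?(neqP b c e) ?(neqP b d e).
  have pY : {subset p <= Y}.
    move=> z; rewrite !inE => /or4P[||| /orP[]] /eqP->;
    by [apply: edgeY eH _ | apply: edgeY fH _].
  have [q [t [ul lY tin wt tg]]] := label_edge v up pY (subsetP HY _ gH).
  set l := p ++ q in ul lY wt tg.
  have ln : size l = #|Y| by rewrite -lY cardsE (card_uniqP ul).
  have l7 : 6 < size l by rewrite ln; case/andP: Yn.
  have wl s := @wf_small T l s l7.
  have d1 : decode v l [:: 0; 1; 2] = e.
    by apply: (decode_sub ul); rewrite ?wl ?H3 //= ve ae be.
  have d2 : decode v l [:: 0; 3; 4] = f.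
    by apply: (decode_sub ul); rewrite ?wl ?H3 //= vf cf df.
  apply: (label_check (fun l ul => disjoint_conflictP (x0 := v) ul iH) ul lY HY
           (base := [:: t; [:: 0; 1; 2]; [:: 0; 3; 4]])).
    apply/allP => s; rewrite !inE => /or3P[] /eqP->; rewrite /has_code inE.
    + by rewrite wt tg.
    + by rewrite wl ?d1.
    + by rewrite wl ?d2.
  have /allP/(_ #|Y|) := intersecting_check; rewrite mem_iota => /(_ Yn)/allP; apply.
  rewrite mem_filter tin andbT -(meetE v ul wt) ?wl // tg.
  rewrite cards_eq0; apply/eqP/setP => z; rewrite !inE /=.
  by case: (z =P v) => [->|]; rewrite ?(negbTE vg) ?andbF.
(* Otherwise intersections of size 0 and 1 are both excluded. *)
have two e f : e \in H -> f \in H -> e != f -> #|e :&: f| = 2.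
  move=> eH fH nef; have := IH _ _ eH fH.
  have ne1 : #|e :&: f| != 1.
    apply: contraNneq no1 => ef; apply/existsP; exists e; apply/existsP; exists f.
    by rewrite eH fH ef.
  have : #|e :&: f| < 3.
    rewrite -(H3 _ eH); apply: proper_card; rewrite properEneq subsetIl andbT.
    apply: contra nef => /eqP efe; rewrite eqEcard (H3 _ eH) (H3 _ fH) andbT.
    by rewrite -efe subsetIr.
  by case: #|_| ne1 => [|[|[|]]].
(* An edge missing [z] in [e] still shares two vertices with [e], hence contains the rest of [e]. *)
have sub e k z : e \in H -> k \in H -> z \in e -> z \notin k -> e :\ z \subset k.
  move=> eH kH ze zk; suff -> : e :\ z = k :&: e by exact: subsetIl.
  apply/esym/eqP; rewrite eqEcard two // ?(eq_sym k) ?(neqP z) //.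
    rewrite -ltnS -(H3 _ eH) (cardsD1 z e) ze add1n ltnSn andbT.
    by apply/subsetP => x; rewrite !inE => /andP[xk ->]; rewrite andbT; apply: neqP xk zk.
  by apply: contraNneq zk => <-.
have [v vY] : exists v, v \in Y by apply/set0Pn; rewrite -card_gt0; case/andP: Yn; case: #|Y|.
have [e eH _] := miss v vY.
have [a ae] : exists a, a \in e by apply/set0Pn; rewrite -card_gt0 H3.
have [f fH af] := miss a (edgeY _ _ eH ae).
have nef : e != f by apply: contraNneq af => <-.
have /cards2P[b [c [bc ef]]] : #|e :&: f| == 2 by rewrite two.
have /cards1P[d fE] : #|f :\: e| == 1 by rewrite cardsD setIC two // H3.
have [/andP[be bf] /andP[ce cf]] :
    (b \in e) && (b \in f) /\ (c \in e) && (c \in f).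
  by rewrite -!in_setI ef !inE !eqxx orbT.
have /andP[de df] : (d \notin e) && (d \in f) by rewrite -in_setD fE inE.
(* With e = abc and f = bcd, an edge missing b must be acd and an edge missing c must be abd: a
   complete 3-graph on a, b, c, d. *)
have [k kH bk] := miss b (edgeY _ _ eH be).
have [m mH cm] := miss c (edgeY _ _ eH ce).
have ab := neqP _ _ _ bf af; have ac := neqP _ _ _ cf af.
have bd := neqP _ _ _ be de; have cd := neqP _ _ _ ce de.
have ad := neqP _ _ _ ae de.
have /subsetP ek := sub _ _ _ eH kH be bk; have /subsetP em := sub _ _ _ eH mH ce cm.
have /subsetP fk := sub _ _ _ fH kH bf bk; have /subsetP fm := sub _ _ _ fH mH cf cm.
pose p := [:: a; b; c; d].
have up : uniq p by rewrite /= !inE !negb_or bc bd cd ad !(eq_sym a) ab ac.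
have pY : {subset p <= Y}.
  by move=> z; rewrite !inE => /or4P[] /eqP->; [apply: edgeY eH _ | apply: edgeY eH _
    | apply: edgeY eH _ | apply: edgeY fH _].
(* Applied to [e] merely to extend [p] to a labelling of [Y]. *)
have [q [_ [ul lY _ _ _]]] := label_edge a up pY (subsetP HY _ eH).
set l := p ++ q in ul lY.
have ln : size l = #|Y| by rewrite -lY cardsE (card_uniqP ul).
have l7 : 6 < size l by rewrite ln; case/andP: Yn.
have wl s := @wf_small T l s l7.
have d1 : decode a l [:: 0; 1; 2] = e.
  by apply: (decode_sub ul); rewrite ?wl ?H3 //= ae be ce.
have d2 : decode a l [:: 1; 2; 3] = f.
  by apply: (decode_sub ul); rewrite ?wl ?H3 //= bf cf df.
have d3 : decode a l [:: 0; 2; 3] = k.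
  apply: (decode_sub ul); rewrite ?wl ?H3 //= ek ?inE ?ae ?andbT 1?eq_sym //.
  by rewrite ek ?fk ?inE ?ce ?df ?andbT // eq_sym.
have d4 : decode a l [:: 0; 1; 3] = m.
  apply: (decode_sub ul); rewrite ?wl ?H3 //= em ?inE ?ae ?andbT 1?eq_sym //.
  by rewrite em ?fm ?inE ?be ?df ?andbT // eq_sym.
apply: (label_check (fun l ul => disjoint_conflictP (x0 := a) ul iH) ul lY HY
  (base := [:: [:: 0; 1; 2]; [:: 0; 1; 3]; [:: 0; 2; 3]; [:: 1; 2; 3]])).
  apply/allP => s; rewrite !inE => /or4P[] /eqP->; rewrite /has_code inE.
  + by rewrite wl ?d1.
  + by rewrite wl ?d4.
  + by rewrite wl ?d3.
  + by rewrite wl ?d2.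
by have /allP/(_ #|Y|) := tetrahedron_check; rewrite mem_iota; apply.
Qed.

Lemma sum_le3 x y : x + y <= 3 -> x != 0 -> y != 0 ->
  [\/ x = 2 /\ y = 1, x = 1 /\ y = 2 | x = 1 /\ y = 1].
Proof.
move=> xy x0 y0; have [x1|x1] : x = 1 \/ x = 2 by lia.
  by have [y1|y1] : y = 1 \/ y = 2 by [lia]; [constructor 3 | constructor 2].
by constructor 1; lia.
Qed.

(** Deleting the centre maps the edges injectively to pairs of other vertices. *)
Lemma star_bound Y H : H \subset triples Y -> star Y H -> #|H| <= 'C(#|Y|.-1, 2).
Proof.
move=> HY /exists_inP[v vY /forall_inP vH].
rewrite -(card_in_imset (f := fun e => e :\ v)); last first.
  by move=> e f /vH ve /vH vf E; rewrite -(setD1K ve) E setD1K.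
have -> : #|Y|.-1 = #|Y :\ v| by rewrite (cardsD1 v Y) vY.
rewrite -cards_draws; apply/subset_leq_card/subsetP => _ /imsetP[e eH ->].
have := subsetP HY e eH; rewrite !inE => /andP[eY e3].
by rewrite setSD //=; move: e3; rewrite (cardsD1 v) (vH _ eH).
Qed.

Definition splits Y H (A : {set T}) :=
  A \subset Y /\ forall e, e \in H -> e \subset A \/ e \subset Y :\: A.

(** A linked configuration yields a part of six vertices whose complement may be small; without one,
    each of the two parts contains an edge. Hence the two alternatives for the sizes. *)
Lemma structure Y H : path_free H -> H \subset triples Y -> 7 <= #|Y| <= 13 ->
  [\/ star Y H, #|H| <= nonstar_bound #|Y|
    | exists2 A, splits Y H A & #|A| == 6 \/ 3 <= #|A| /\ 3 <= #|Y :\: A|].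
Proof.
move=> pf HY Yn; have [st|nst] := boolP (star Y H); first by constructor 1.
have [iH|] := boolP (intersecting H); first by constructor 2; apply: intersecting_bound.
have /path_freeP PF := pf.
have H3 := card_triple HY.
have eY e : e \in H -> e \subset Y by move=> /(subsetP HY); rewrite inE => /andP[].
case/forall_inPn => e0 e0H /forall_inPn[f0 f0H]; rewrite negbK => ef0.
pose linked := [exists e in H, exists f in H, exists h in H,
  [&& #|e :&: f| == 0, #|e :&: h| == 2 & #|h :&: f| == 1]].
(* An edge meeting two disjoint edges has intersection sizes 2 and 1 with them, in some order, or 1
   and 1; the latter is a path. *)
have link e f h : e \in H -> f \in H -> h \in H -> #|e :&: f| = 0 ->
    #|e :&: h| != 0 -> #|h :&: f| != 0 -> linked.
  move=> eH fH hH ef eh hf.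
  have le3 : #|e :&: h| + #|h :&: f| <= 3.
    rewrite -(H3 h hH) setIC -cardsUI addnC.
    have -> : #|(h :&: e) :&: (h :&: f)| = 0.
      apply/eqP; rewrite cards_eq0 -subset0; move/eqP: ef; rewrite cards_eq0 => /eqP <-.
      by rewrite setIACA setIid subsetIr.
    by rewrite add0n; apply/subset_leq_card; rewrite subUset !subsetIl.
  have := PF e h f eH hH fH; rewrite /loose ef.
  have [[E1 E2]|[E1 E2]|[E1 E2]] := sum_le3 le3 eh hf; last by rewrite E1 E2.
    by move=> _; apply/exists_inP; exists e => //; apply/exists_inP; exists f => //;
      apply/exists_inP; exists h => //; rewrite ef E1 E2.
  by move=> _; apply/exists_inP; exists f => //; apply/exists_inP; exists e => //;
    apply/exists_inP; exists h => //; rewrite setIC ef (setIC f) E2 (setIC h) E1.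
have [/exists_inP[e eH /exists_inP[f fH /exists_inP[h hH]]]|nl] := boolP linked.
- move=> /and3P[/eqP ef /eqP eh /eqP hf].
  have SY : e :|: f \subset Y by rewrite subUset !eY.
  have [/exists_inP[g gH g3]|/exists_inPn ng] :=
      boolP [exists g in H, 0 < #|g :&: (e :|: f)| < 3].
    by constructor 2; apply: (config_bound pf HY Yn eH fH hH gH).
  constructor 3; exists (e :|: f); last by left; rewrite cardsU ef !H3.
  split=> // g gH; have := ng g gH.
  have := subset_leq_card (subsetIl g (e :|: f)); rewrite (H3 g gH) => le3.
  rewrite negb_and -!leqNgt leqn0 => /orP[g0|ge3]; [right|left].
    by rewrite subsetD eY //= -setI_eq0 -cards_eq0.
  by apply/setIidPl/eqP; rewrite eqEcard subsetIl H3.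
pose A := \bigcup_(g in H | #|g :&: e0| != 0) g.
have AE g : g \in H -> #|g :&: e0| != 0 -> g \subset A.
  by move=> gH ge; apply: (bigcup_max g) => //; rewrite gH.
have AY : A \subset Y by apply/bigcupsP => g /andP[/eY].
(* An edge [k] meeting both [e0] and an edge [g] disjoint from [e0] would make a link. *)
have off g : g \in H -> #|g :&: e0| = 0 -> g \subset Y :\: A.
  move=> gH ge; rewrite subsetD eY //= disjoint_sym disjoints_subset.
  apply/bigcupsP => k /andP[kH ke]; rewrite -disjoints_subset -setI_eq0 -cards_eq0.
  apply: contraNT nl => kg; apply: (link g e0 k) => //; by rewrite setIC.
constructor 3; exists A.
  split=> // g gH; have [/off|] := eqVneq #|g :&: e0| 0; first by right; auto.
  by left; apply: AE.
right; rewrite -{1}(H3 _ e0H) -(H3 _ f0H).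
split; apply: subset_leq_card; first by apply: AE; rewrite ?setIid ?H3.
by apply: off => //; rewrite setIC; apply/eqP.
Qed.

Lemma splits_card Y H (A : {set T}) : H \subset triples Y -> splits Y H A ->
  #|H| <= #|H :&: triples A| + #|H :&: triples (Y :\: A)|.
Proof.
move=> HY [_ sp]; apply: leq_trans (leq_card_setU _ _).
apply/subset_leq_card/subsetP => e eH; have := subsetP HY e eH.
by rewrite !inE eH => /andP[_ ->]; rewrite !andbT; case: (sp e eH) => ->; rewrite ?orbT.
Qed.

Lemma path_freeS H (K : {set {set T}}) : K \subset H -> path_free H -> path_free K.
Proof.
move=> /subsetP KH /path_freeP F; apply/path_freeP => a b c /KH aH /KH bH /KH cH.
exact: F.
Qed.

(** For n <= 10: C(n,3) up to n = 6, and from n = 7 on a number at least C(n-1,2) and at least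
    [nonstar_bound n]. *)
Definition turan_bound (n : nat) : nat :=
  nth 0 [:: 0; 0; 0; 1; 4; 10; 20; 20; 28; 28; 36] n.

(** In the exceptional case the two halves allow 20 + 20 = 40 edges, above the bound 35 for twelve
    vertices. *)
Lemma split_bound a b : 7 <= a + b <= 13 -> a == 6 \/ 3 <= a /\ 3 <= b ->
  turan_bound a + turan_bound b <= nonstar_bound (a + b) \/ a = 6 /\ b = 6.
Proof.
have : all (fun x => all (fun y => [&& 7 <= x + y <= 13 & (x == 6) || (2 < x) && (2 < y)]
    ==> [|| turan_bound x + turan_bound y <= nonstar_bound (x + y)
         | (x == 6) && (y == 6)]) (iota 0 14)) (iota 0 14) by vm_compute.
move=> + ab cond; move=> /allP/(_ a); rewrite mem_iota => /(_ ltac:(lia)).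
move=> /allP/(_ b); rewrite mem_iota => /(_ ltac:(lia)) /implyP.
have -> : (a == 6) || (2 < a) && (2 < b).
  by case: cond => [->|[-> ->]] //; rewrite orbT.
by rewrite ab => /(_ isT) /orP[->|/andP[/eqP-> /eqP->]]; [left | right].
Qed.

(** Induction on the number of vertices: when H splits, both parts are smaller than [Y]. *)
Lemma turan Y H : path_free H -> H \subset triples Y -> #|Y| <= 10 ->
  #|H| <= turan_bound #|Y|.
Proof.
have [n] := ubnP #|Y|; elim: n => // n IH in Y H *; rewrite ltnS => Yn pf HY Y10.
have [Y6|Y7] := leqP #|Y| 6.
  apply: leq_trans (subset_leq_card HY) _; rewrite cards_draws.
  by case: #|Y| Y6 => [|[|[|[|[|[|[|]]]]]]].
have Y13 : 7 <= #|Y| <= 13 by rewrite Y7 (leq_trans Y10).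
have le : nonstar_bound #|Y| <= turan_bound #|Y|.
  by move: #|Y| Y7 Y10 => m; do 11!case: m => [|m] //.
have [st|le'|[A spA cA]] := structure pf HY Y13; last 2 first.
- exact: leq_trans le.
- have AY : #|A| + #|Y :\: A| = #|Y|.
    by rewrite -(cardsID A Y) (setIidPr (proj1 spA)).
  have [A6 D1] : 3 <= #|A| /\ 0 < #|Y :\: A| by case: cA => [/eqP|[]]; lia.
  have sub (B : {set T}) : #|B| < #|Y| -> #|H :&: triples B| <= turan_bound #|B|.
    move=> lt; apply: IH; rewrite ?subsetIr //; last by lia.
      exact: leq_trans lt Yn.
    exact: path_freeS (subsetIl _ _) pf.
  apply: leq_trans (splits_card HY spA) _.
  apply: leq_trans (leq_add (sub A _) (sub (Y :\: A) _)) _; try by lia.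
  move: Y13; rewrite -AY => /split_bound/(_ cA)[|[a6 b6]]; last by lia.
  by move=> /leq_trans; apply; rewrite AY.
apply: leq_trans (star_bound HY st) _.
by move: #|Y| Y7 Y10 => m; do 11!case: m => [|m] //.
Qed.

(** When H splits, each part has at most ten vertices, so [turan] bounds it. *)
Lemma nonstar Y H : path_free H -> H \subset triples Y -> 7 <= #|Y| <= 13 ->
  ~~ star Y H -> #|H| <= nonstar_bound #|Y| \/
  exists2 A, splits Y H A & #|A| = 6 /\ #|Y :\: A| = 6.
Proof.
move=> pf HY Y13 /negP nst; have [//|le|[A spA cA]] := structure pf HY Y13.
  by left.
have AY : #|A| + #|Y :\: A| = #|Y|.
  by rewrite -(cardsID A Y) (setIidPr (proj1 spA)).
move: (Y13); rewrite -{1 2}AY => /split_bound/(_ cA)[le|]; last by right; exists A.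
have [A10 B10] : #|A| <= 10 /\ #|Y :\: A| <= 10 by case: cA => [/eqP|[]]; lia.
left; apply: leq_trans (splits_card HY spA) _; rewrite -AY; apply: leq_trans le.
by apply: leq_add; apply: turan; rewrite ?subsetIr //;
  apply: path_freeS (subsetIl _ _) pf.
Qed.

End Structure.

(** * Covering all triples by colour classes *)

Section Colouring.

Variable T : finType.
Implicit Types (X Y A e : {set T}) (H D : {set {set T}}) (Hs : seq {set {set T}}).

Lemma triplesI X Y : triples X :&: triples Y = triples (X :&: Y).
Proof. by apply/setP => e; rewrite !inE subsetI; case: (#|e| == 3); rewrite ?andbF ?andbT. Qed.

Lemma triples_disjoint X Y : X :&: Y = set0 -> triples X :&: triples Y = set0.
Proof.
move=> XY; rewrite triplesI XY; apply/setP => e; rewrite !inE subset0.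
by case: eqP => // ->; rewrite cards0.
Qed.

Lemma card_triplesU X Y : X :&: Y = set0 ->
  #|triples X :|: triples Y| = 'C(#|X|, 3) + 'C(#|Y|, 3).
Proof. by move=> XY; rewrite cardsU triples_disjoint // cards0 subn0 !cards_draws. Qed.

Lemma cover_card Hs D :
  (forall e, e \in D -> has (fun H => e \in H) Hs) ->
  #|D| <= \sum_(H <- Hs) #|H :&: D|.
Proof.
move=> cov.
suff : #|[set e in D | has (fun H => e \in H) Hs]| <= \sum_(H <- Hs) #|H :&: D|.
  apply: leq_trans; apply: subset_leq_card; apply/subsetP => e eD.
  by rewrite inE eD cov.
elim: Hs {cov} => [|H Hs IH].
  by rewrite big_nil leqn0 cards_eq0; apply/eqP/setP => e; rewrite !inE andbF.
rewrite big_cons; apply: leq_trans (leq_add (leqnn _) IH).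
apply: leq_trans (leq_card_setU _ _); apply/subset_leq_card/subsetP => e.
rewrite !inE => /andP[-> /= /orP[-> // | eHs]].
by apply/orP; right.
Qed.

Lemma sum_seq_leq Hs D b : (forall H, H \in Hs -> #|H :&: D| <= b) ->
  \sum_(H <- Hs) #|H :&: D| <= size Hs * b.
Proof.
move=> le; rewrite big_seq.
apply: (@leq_trans (\sum_(H <- Hs | H \in Hs) b)); first exact: leq_sum.
by rewrite -big_seq big_const_seq count_predT iter_addn_0 mulnC.
Qed.

(** Finite choice along a list, used to pick one half for each colour class while keeping the number
    of classes. *)
Lemma choose_seq (U V : eqType) (s : seq U) (P : U -> V -> Prop) :
  (forall x, x \in s -> exists y, P x y) ->
  exists2 t : seq V, size t = size s &
    (forall y, y \in t -> exists2 x, x \in s & P x y) /\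
    (forall x, x \in s -> exists2 y, y \in t & P x y).
Proof.
elim: s => [|x s IH] ex; first by exists [::].
have [y Pxy] := ex x (mem_head _ _).
have [|t st [ts sst]] := IH; first by move=> z zs; apply: ex; rewrite inE zs orbT.
exists (y :: t); first by rewrite /= st.
split=> z; rewrite inE => /predU1P[->|].
- by exists x => //; rewrite mem_head.
- by case/ts => u us Puz; exists u; rewrite // inE us orbT.
- by exists y => //; rewrite mem_head.
- by case/sst => u us Puz; exists u; rewrite // inE us orbT.
Qed.

(** * Splittings of twelve vertices into halves *)

Section Halves.

Variable Y : {set T}.
Hypothesis Y12 : #|Y| = 12.

Definition halves A e := (e \subset A) || (e \subset Y :\: A).

Lemma card_half A : A \subset Y -> #|A| = 6 -> #|Y :\: A| = 6.
Proof. by move=> AY A6; rewrite cardsD (setIidPr AY) Y12 A6. Qed.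

(** If [X] has a vertices in [A], it contains 20 - C(a,3) - C(6-a,3) crossing triples, at most 18,
    the value at a = 3. *)
Lemma crossing_half A X : A \subset Y -> X \subset Y -> #|X| = 6 ->
  #|triples X :\: (triples A :|: triples (Y :\: A))| <= 18.
Proof.
move=> AY XY X6; rewrite cardsD setIUr !triplesI card_triplesU.
  rewrite cards_draws X6.
  have : #|X :&: A| + #|X :&: (Y :\: A)| = 6.
    by rewrite setIDA (setIidPl XY) cardsID.
  move: #|_| #|_| => a b ab.
  have -> : b = 6 - a by lia.
  have : a <= 6 by lia.
  by case: a {ab} => [|[|[|[|[|[|[|]]]]]]].
by apply/setP => x; rewrite !inE; case: (x \in A); rewrite ?andbF.
Qed.

(** This is C(12,3) - 2 C(6,3) = 220 - 40. *)
Lemma card_crossing A : A \subset Y -> #|A| = 6 ->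
  #|triples Y :\: (triples A :|: triples (Y :\: A))| = 180.
Proof.
move=> AY A6; rewrite cardsD (setIidPr _).
  rewrite card_triplesU ?cards_draws ?card_half ?Y12 ?A6 //.
  by apply/setP => x; rewrite !inE; case: (x \in A).
by apply/subsetP => e; rewrite !inE -andb_orl => /andP[/orP[/subset_trans->|/subset_trans->]] //;
  apply: subsetDl.
Qed.

(** Each half of the splitting class contributes at most 18. *)
Lemma halves_crossing A X H : A \subset Y -> X \subset Y -> #|X| = 6 ->
  H \subset triples Y -> splits Y H X ->
  #|H :&: (triples Y :\: (triples A :|: triples (Y :\: A)))| <= 36.
Proof.
move=> AY XY X6 HY [_ sp].
have := leq_add (crossing_half AY XY X6)
                (crossing_half AY (subsetDl Y X) (card_half XY X6)).
apply: leq_trans; apply: leq_trans (leq_card_setU _ _).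
apply/subset_leq_card/subsetP => e /setIP[eH].
rewrite !in_setU !in_setD !in_setU => /andP[-> eY].
by move: eY; rewrite !inE => /andP[_ ->]; rewrite !andbT; case: (sp e eH) => ->; rewrite ?orbT.
Qed.

(** Fix v. Each splitting puts five other vertices on the side of v, so over the eleven candidates u
    the agreements with v total 30 < 33, and some u is on the side of v in at most two splittings.
    Each of these rules out four further vertices, together at most 8 of the remaining 10. Any w
    left gives a triple v, u, w crossing in all six splittings. *)
Lemma six_halves (As : seq {set T}) : size As = 6 ->
  (forall A, A \in As -> A \subset Y /\ #|A| = 6) ->
  exists2 e, e \in triples Y & ~~ has (halves^~ e) As.
Proof.
move=> s6 hA; have [v vY] : exists v, v \in Y by apply/set0Pn; rewrite -card_gt0 Y12.
pose agree A u := (u \in A) == (v \in A).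
pose N A := [set u in Y :\ v | agree A u].
have card_N A : A \in As -> #|N A| = 5.
  move=> /hA[AY A6]; have [vA|vA] := boolP (v \in A).
    have -> : N A = A :\ v.
      apply/setP => u; rewrite !inE /agree vA eqb_id.
      by case: (boolP (u \in A)) => [/(subsetP AY)->|]; rewrite ?andbF ?andbT.
    by have := cardsD1 v A; rewrite vA A6 add1n => -[].
  have -> : N A = (Y :\: A) :\ v.
    by apply/setP => u; rewrite !inE /agree (negbTE vA) eqbF_neg; case: (u \in A); rewrite ?andbF ?andbT.
  by have := cardsD1 v (Y :\: A); rewrite inE vA vY card_half // add1n => -[].
have Yv : #|Y :\ v| = 11 by have := cardsD1 v Y; rewrite vY Y12 add1n => -[].
have [u uY u2] : exists2 u, u \in Y :\ v & count (agree^~ u) As <= 2.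
  apply/exists_inP; apply: contraT => /exists_inPn no.
  have : \sum_(u in Y :\ v) 3 <= \sum_(u in Y :\ v) count (agree^~ u) As.
    by apply: leq_sum => u /no; rewrite -ltnNge.
  rewrite sum_nat_const Yv.
  under [X in _ <= X]eq_bigr do rewrite -sum1_count big_mkcond.
  rewrite exchange_big /= big_seq.
  under eq_bigr => A /card_N A5 do rewrite -big_mkcondr sum1dep_card A5.
  by rewrite -big_seq big_const_seq count_predT iter_addn_0 s6.
pose bad := \bigcup_(A <- As | agree A u) (N A :\ u).
have bad8 : #|bad| <= 8.
  apply: leq_trans (_ : \sum_(A <- As | agree A u) 4 <= 8); last first.
    by rewrite big_const_seq iter_addn_0; lia.
  rewrite /bad big_seq_cond [X in _ <= X]big_seq_cond.
  elim/big_rec2: _ => [|A m B /andP[AAs Au] le]; first by rewrite cards0.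
  apply: leq_trans (leq_card_setU _ _) _; apply: leq_add le.
  by have := cardsD1 u (N A); rewrite card_N // inE uY Au add1n => -[<-].
have [w] : exists w, w \in (Y :\ v :\ u) :\: bad.
  apply/set0Pn; rewrite -card_gt0 cardsD subn_gt0.
  apply: leq_ltn_trans (subset_leq_card (subsetIr _ _)) _.
  by have := cardsD1 u (Y :\ v); rewrite uY Yv add1n => -[<-]; apply: leq_ltn_trans bad8 _.
rewrite 3!inE => /and3P[wbad wu wY].
have [uv uY'] : u != v /\ u \in Y by move: uY; rewrite !inE => /andP[].
have [wv wY'] : w != v /\ w \in Y by move: wY; rewrite !inE => /andP[].
exists [set v; u; w].
  rewrite inE !subUset !sub1set vY uY' wY' /=.
  by rewrite setUC cardsU1 cards2 !inE negb_or wv wu (eq_sym v) uv.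
apply: contra wbad => /hasP[A AAs hAe].
have [Au Aw] : agree A u /\ agree A w.
  move: hAe; rewrite /halves /agree !subUset !sub1set !inE.
  by move=> /orP[/andP[/andP[-> ->] ->] //|/andP[/andP[/andP[/negbTE-> _] /andP[/negbTE-> _]] /andP[/negbTE-> _]]].
rewrite /bad (big_rem A) //= Au in_setU; apply/orP; left.
by rewrite in_setD1 wu inE wY.
Qed.

End Halves.

(** The classes need only cover the triples of [Y], so the same families can be used again after a
    vertex is deleted. *)
Lemma no_colouring r Hs Y :
  r <= 7 -> size Hs = r -> all (@path_free _) Hs -> #|Y| = r + 6 ->
  (forall e, e \in triples Y -> has (fun H => e \in H) Hs) -> False.
Proof.
elim: r => [|r IH] in Hs Y *.
  move=> _ /size0nil-> _ Y6 cov.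
  have /card_gt0P[e /cov] // : 0 < #|triples Y| by rewrite cards_draws Y6.
move=> r7 sHs /allP pf Yr cov.
have [/hasP[H HHs /exists_inP[v vY /forall_inP st]]|/hasPn nst] :=
    boolP (has (fun H => star Y (H :&: triples Y)) Hs).
  (* Triples avoiding the centre [v] lie outside [H], so the other classes cover them. *)
  apply: (IH (rem H Hs) (Y :\ v)); first exact: ltnW.
  - by rewrite size_rem // sHs.
  - by apply/allP => K /mem_rem /pf.
  - by apply/eqP; rewrite -(eqn_add2l (v \in Y)) -cardsD1 Yr vY.
  move=> e; rewrite inE subsetD1 => /andP[/andP[eY ve] e3].
  have eT : e \in triples Y by rewrite inE eY.
  have /hasP[K KHs eK] := cov e eT; apply/hasP; exists K => //.
  apply: rem_mem => //; apply: contraNneq ve => KH.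
  by apply: st; rewrite inE -KH eK.
have Y13 : 7 <= #|Y| <= 13 by lia.
have ns H : H \in Hs -> #|H :&: triples Y| <= nonstar_bound #|Y| \/
    exists2 A, splits Y (H :&: triples Y) A & #|A| = 6 /\ #|Y :\: A| = 6.
  move=> HHs; apply: nonstar; rewrite ?subsetIr // ?nst //.
  exact: path_freeS (subsetIl _ _) (pf H HHs).
pose small H := #|H :&: triples Y| <= nonstar_bound #|Y|.
have [/allP sm|/allPn[H0 H0Hs H0big]] := boolP (all small Hs).
  (* For k = 1, ..., 7 classes, k times [nonstar_bound (k + 6)] is less than C(k+6,3). *)
  have := leq_trans (cover_card cov) (sum_seq_leq sm).
  rewrite cards_draws Yr sHs.
  by case: (r) r7 => [|[|[|[|[|[|[|]]]]]]]; vm_compute.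
have [le|[A spA [A6 B6]]] := ns H0 H0Hs; first by case/negP: H0big.
have AY := proj1 spA.
have Y12 : #|Y| = 12 by rewrite -(cardsID A Y) (setIidPr AY) A6 B6.
have s6 : size Hs = 6 by lia.
(* If no class is small, all six split into halves, and [six_halves] gives an uncovered triple. *)
have [/hasP[H1 H1Hs H1small]|/hasPn nsmall] := boolP (has small Hs); last first.
  have [|As sAs [Asin inAs]] := @choose_seq _ _ Hs
    (fun H (X : {set T}) => splits Y (H :&: triples Y) X /\ #|X| = 6).
    move=> H HHs; have [le|[X spX [X6 _]]] := ns H HHs; last by exists X.
    by have := nsmall H HHs; rewrite /small le.
  have [||e eY] := six_halves Y12 (As := As); first by rewrite sAs.
    by move=> X /Asin[H _ [[XY _] X6]].
  have /hasP[H HHs eH] := cov e eY; have [X XAs [[_ spX] _]] := inAs H HHs.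
  case/hasP; exists X => //; apply/orP; apply: spX.
  by rewrite inE eH.
pose D := triples Y :\: (triples A :|: triples (Y :\: A)).
have DI H : H :&: D = (H :&: triples Y) :&: D.
  by rewrite -setIA (setIidPr (subsetDl _ _)).
have D36 H : H \in Hs -> #|H :&: D| <= 36.
  move=> HHs; rewrite DI; have [le|[X spX [X6 _]]] := ns H HHs.
    apply: leq_trans (subset_leq_card (subsetIl _ _)) _.
    by apply: leq_trans le _; rewrite Y12.
  by apply: (halves_crossing Y12 AY (proj1 spX) X6 _ spX); rewrite subsetIr.
have H0D : #|H0 :&: D| = 0.
  apply/eqP; rewrite cards_eq0 DI; apply/eqP/setP => e; rewrite in_set0.
  apply/negbTE; rewrite in_setI in_setD in_setU; apply/negP => /and3P[eH0 + eY].
  move: (eH0) eY; rewrite !inE => /andP[_ /andP[_ ->]] _; rewrite !andbT.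
  by case: (proj2 spA e eH0) => ->; rewrite ?orbT.
have H1D : #|H1 :&: D| <= 35.
  rewrite DI; apply: leq_trans (subset_leq_card (subsetIl _ _)) _.
  by move: H1small; rewrite /small Y12.
have H1rem : H1 \in rem H0 Hs.
  by apply: rem_mem => //; apply: contraNneq H0big => <-.
have : #|D| <= \sum_(H <- Hs) #|H :&: D|.
  by apply: cover_card => e /setDP[/cov].
rewrite (perm_big _ (perm_to_rem H0Hs)) big_cons H0D.
rewrite (perm_big _ (perm_to_rem H1rem)) big_cons (card_crossing Y12 AY A6).
(* The classes contain at most 0 + 35 + 4 * 36 = 179 of the 180 crossing triples. *)
have := @sum_seq_leq (rem H1 (rem H0 Hs)) D 36.
rewrite !size_rem // s6 => le4.
have {}le4 := le4 (fun H HHs => D36 H (mem_rem (mem_rem HHs))).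
move=> /= le180; have : 180 <= #|H1 :&: D| + \sum_(H <- rem H1 (rem H0 Hs)) #|H :&: D| by [].
move: H1D le4; move: (\sum_(_ <- _) _) => x; lia.
Qed.

End Colouring.

(** * Upper and lower bound for the Ramsey number *)

Lemma arrows_upper r : 1 <= r <= 7 -> arrows_P r (r + 6).
Proof.
move=> /andP[_ r7] col.
pose H (i : 'I_r) : {set {set 'I_(r + 6)}} := [set val x | x : edge3 (r + 6) & col x == i].
have [/allP pf|/allPn[_ /mapP[i _ ->]]] := boolP (all (@path_free _) [seq H i | i <- enum 'I_r]).
  case: (@no_colouring _ r [seq H i | i <- enum 'I_r] setT r7) => //.
  - by rewrite size_map size_enum_ord.
  - exact/allP.
  - by rewrite cardsT card_ord.
  move=> e; rewrite inE => /andP[_ e3]; apply/hasP.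
  exists (H (col (exist _ e e3))); first by rewrite map_f ?mem_enum.
  by apply/imsetP; exists (exist _ e e3); rewrite ?inE.
case/forall_inPn => _ /imsetP[[A A3] /[!inE] /eqP cA ->].
case/forall_inPn => _ /imsetP[[B B3] /[!inE] /eqP cB ->].
case/forall_inPn => _ /imsetP[[C C3] /[!inE] /eqP cC ->] /=; rewrite negbK.
case/and3P => AB BC; rewrite cards_eq0 => /eqP AC.
have /cards1P[c cE] := AB; have /cards1P[e eE] := BC.
have /cards2P[a [b [ab abE]]] : #|A :\: B| == 2.
  by rewrite cardsD (eqP A3) (eqP AB).
have /cards2P[f [g [fg fgE]]] : #|C :\: B| == 2.
  by rewrite cardsD (eqP C3) setIC (eqP BC).
have disj z : z \in A -> z \in C = false.
  by move=> zA; have /setP/(_ z) := AC; rewrite !inE zA.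
pose mem3 z := (z \in A, z \in B, z \in C).
have mc : mem3 c = (true, true, false).
  by have := set11 c; rewrite -cE inE /mem3 => /andP[cA' ->]; rewrite cA' disj.
have me : mem3 e = (false, true, true).
  have := set11 e; rewrite -eE inE /mem3 => /andP[-> eC]; rewrite eC.
  by congr (_, _, _); apply: contraTF eC => /disj->.
have [ma mb] : mem3 a = (true, false, false) /\ mem3 b = (true, false, false).
  by split; [have := set21 a b | have := set22 a b];
     rewrite -abE inE /mem3 => /andP[/negbTE-> zA]; rewrite zA disj.
have [mf mg] : mem3 f = (false, false, true) /\ mem3 g = (false, false, true).
  by split; [have := set21 f g | have := set22 f g];
     rewrite -fgE inE /mem3 => /andP[/negbTE-> zC]; rewrite zC;
     congr (_, _, _); apply: contraTF zC => /disj->.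
have neq u v : mem3 u != mem3 v -> u != v by apply: contraNneq => ->.
have BAC : B :&: (A :|: C) = [set c; e] by rewrite setIUr setIC cE eE.
have /cards1P[d dE] : #|B :\: (A :|: C)| == 1.
  by rewrite cardsD (eqP B3) BAC cards2 neq // mc me.
have md : mem3 d = (false, true, false).
  have := set11 d; rewrite -dE !inE negb_or /mem3.
  by move=> /andP[/andP[/negbTE-> /negbTE->] ->].
have up : uniq [:: a; b; c; d; e; f; g].
  by rewrite /= !inE !negb_or ab fg !neq ?ma ?mb ?mc ?md ?me ?mf ?mg.
have AE : A = [set a; b; c] by rewrite -(setID A B) cE abE setUC.
have BE : B = [set c; d; e] by rewrite -(setID B (A :|: C)) BAC dE setUAC.
have CE : C = [set e; f; g] by rewrite -(setID C B) setIC eE fgE setUA.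
(* The cardinality proofs occur inside the coloured edges, so they are generalized before the sets
   are rewritten. *)
move: A3 B3 C3 cA cB cC {AB BC AC cE eE abE fgE disj mem3 mc me ma mb mf mg neq BAC dE md}.
rewrite AE BE CE => A3 B3 C3 cA cB cC.
by exists a, b, c, d, e, f, g, A3, B3, C3; rewrite cA cB cC.
Qed.

(** Colour a triple by its least vertex if that is below r - 1, and by r - 1 otherwise. Triples of
    an earlier colour share a vertex, whereas the end edges of a path are disjoint; for n < r + 6
    the last colour lives on at most six vertices, and a path has seven. *)
Lemma arrows_lower r n : 0 < r -> arrows_P r n -> r + 6 <= n.
Proof.
case: r => // r _ arr; rewrite leqNgt; apply/negP; rewrite addSn ltnS => nr.
(* There are now [r.+1] colours; [find] returns [r], the last of them, when [S] has no vertex below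
   [r]. *)
pose least (S : {set 'I_n}) := find (fun k => [exists i in S, val i == k]) (iota 0 r).
have least_le S : least S < r.+1.
  by rewrite ltnS -(size_iota 0 r); apply: find_size.
have least_in S : least S < r -> exists2 i, i \in S & val i = least S.
  move=> lt; have := lt; rewrite -{1}(size_iota 0 r) -has_find => /(nth_find 0).
  by rewrite nth_iota // => /exists_inP[i iS /eqP]; exists i.
have least_out S i : least S = r -> i \in S -> r <= val i.
  move=> E iS; rewrite leqNgt; apply/negP => lt.
  have : ~~ has (fun k => [exists i in S, val i == k]) (iota 0 r).
    by rewrite has_find -/(least S) E size_iota ltnn.
  move/hasPn/(_ (val i)); rewrite mem_iota => /(_ lt); case/negP.
  by apply/exists_inP; exists i.
have [a [b [c [d [e [f [g [E1 [E2 [E3 [up [c12 c23]]]]]]]]]]]] :=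
  arr (fun x => Ordinal (least_le (val x))).
have {c12}l12 : least [set a; b; c] = least [set c; d; e] by case: c12.
have {c23}l23 : least [set c; d; e] = least [set e; f; g] by case: c23.
have := least_le [set a; b; c]; rewrite ltnS leq_eqVlt => /predU1P[l1|lt1].
  have : uniq (map val [:: a; b; c; d; e; f; g]) by rewrite map_inj_uniq //; apply: val_inj.
  move=> um; suff sub : {subset map val [:: a; b; c; d; e; f; g] <= iota r 6}.
    by have := uniq_leq_size um sub.
  move=> _ /mapP[x xin ->]; rewrite mem_iota (leq_trans (ltn_ord x)) // andbT.
  have [l2 l3] : least [set c; d; e] = r /\ least [set e; f; g] = r.
    by rewrite -l23 -l12.
  have /or3P[] : [|| x \in [set a; b; c], x \in [set c; d; e] | x \in [set e; f; g]].
    by move: xin; rewrite !inE; do ![case: (x == _) => //=].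
  - exact: least_out.
  - exact: least_out.
  - exact: least_out.
have [i iA vi] := least_in _ lt1.
have [j jC vj] := least_in [set e; f; g] ltac:(by rewrite -l23 -l12).
have ij : i = j by apply: val_inj; rewrite vi vj l12.
move: iA jC up; rewrite {}ij !inE -!orbA => /or3P[] /eqP-> /or3P[] /eqP E;
  by rewrite /= !inE E !eqxx ?orbT ?andbF.
Qed.

Theorem theorem1 (r : nat) : 1 <= r <= 7 -> is_ramsey_P r (r + 6).
Proof.
move=> r17; split; first exact: arrows_upper.
by move=> n; apply: arrows_lower; case/andP: r17.
Qed.
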